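(* Consider an open quantum system on a finite-dimensional Hilbert space $\mathcal H$ with Hamiltonian $H$. Let $W_1,\dots,W_N$ be observables commuting with $H$, each positive semidefinite with smallest eigenvalue $0$; for $n\in\{1,\dots,N\}$ let $\widetilde W_n=\sum_{\lambda=1}^nW_\lambda$ and let $d_n$ be the smallest eigenvalue of $\widetilde W_n$. Fix $n<N$. Suppose that with coupling operators $L_1,\dots,L_M$ one has $\mathcal G_M(\widetilde W_n)\le0$ and $\mathfrak D_M(\widetilde W_n-d_n)\ge c(\widetilde W_n-d_n)$ for some $c>0$, where $\mathcal G_M,\mathfrak D_M$ denote the generator and dissipation functional with couplings $L_1,\dots,L_M$. Let $L_{M+1},\dots,L_K$ be additional coupling operators, and let $\mathcal G$, $\mathfrak D$ denote the generator and dissipation functional with all couplings $L_1,\dots,L_K$. If $\mathcal G(W_{n+1})+\sum_{k=M+1}^K\mathcal G(\widetilde W_n)_{L_k}\le0$ and $\mathfrak D(W_{n+1})+2\sum_{k=1}^K\operatorname{Re}\big([L_k^\dagger,\widetilde W_n][W_{n+1},L_k]\big)\ge cW_{n+1}-c(d_{n+1}-d_n)$, then $\widetilde W_{n+1}$ is asymptotically ground-state stable for the system with couplings $L_1,\dots,L_K$.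
   Context: With couplings $L_1,\dots,L_J$ the density state (positive semidefinite, trace one) evolves by $\dot\rho_t=-i[H,\rho_t]+\sum_{k=1}^J\big(L_k\rho_tL_k^\dagger-\tfrac12L_k^\dagger L_k\rho_t-\tfrac12\rho_tL_k^\dagger L_k\big)$; the corresponding generator on observables commuting with $H$ is $\sum_{k=1}^J\mathcal G(X)_{L_k}$ with $\mathcal G(X)_{L_k}=L_k^\dagger XL_k-\tfrac12L_k^\dagger L_kX-\tfrac12XL_k^\dagger L_k$, and $\frac{d}{dt}\operatorname{tr}(X\rho_t)=\operatorname{tr}(\mathcal G(X)\rho_t)$. The dissipation functional is $\mathfrak D(X)=\mathcal G(X^\dagger X)-\mathcal G(X^\dagger)X-X^\dagger\mathcal G(X)$, equal to $\sum_k[L_k^\dagger,X][X,L_k]$ for self-adjoint $X$. $\operatorname{Re}(Y)=\tfrac12(Y+Y^\dagger)$. Constants are identified with multiples of the identity. An observable $X$ with smallest eigenvalue $d$ is asymptotically ground-state stable if $\operatorname{tr}(X\rho_t)\to d$ as $t\to\infty$ for every initial density state. *)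

(* Defs.v *)
From HB Require Import structures.
From mathcomp Require Import all_boot all_order all_algebra.
From mathcomp Require Import all_classical all_reals all_analysis.
From mathcomp Require Import complex.
Set Implicit Arguments. Unset Strict Implicit. Unset Printing Implicit Defensive.
Import Order.TTheory GRing.Theory Num.Theory.
Import numFieldNormedType.Exports.
Local Open Scope ring_scope.
Local Open Scope classical_set_scope.

(* Hilbert space = C^dim, with C = R[i] (complex numbers over a realType R).
   Operators are dim x dim complex matrices. *)

Section Defs.
Variables (R : realType) (dim : nat).
Local Notation C := (R[i]).
Local Notation M := ('M[C]_dim).

Definition dag (m n : nat) (A : 'M[C]_(m, n)) : 'M[C]_(n, m) :=
  (map_mx Num.conj A)^T.

Definition is_herm (A : M) : Prop := dag A = A.

Definition opcomm (A B : M) : M := A *m B - B *m A.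

Definition ReOp (Y : M) : M := 2^-1 *: (Y + dag Y).

Definition is_psd (A : M) : Prop :=
  is_herm A /\ forall v : 'cV[C]_dim, 0 <= (dag v *m A *m v) 0 0.

Definition loewner_le (A B : M) : Prop := is_psd (B - A).

Definition min_eig (A : M) (d : R) : Prop :=
  eigenvalue A ((d%:C)%C) /\ forall a : C, eigenvalue A a -> (d%:C)%C <= a.

Definition is_density (rho : M) : Prop := is_psd rho /\ \tr rho = 1.

(* single-coupling generator G(X)_L (Hamiltonian part omitted since the
   observables considered commute with H) *)
Definition GenL (L X : M) : M :=
  dag L *m X *m L - 2^-1 *: (dag L *m L *m X) - 2^-1 *: (X *m dag L *m L).

Definition Gen (L : nat -> M) (a b : nat) (X : M) : M :=
  \sum_(a <= k < b) GenL (L k) X.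

Definition Diss (L : nat -> M) (a b : nat) (X : M) : M :=
  Gen L a b (dag X *m X) - Gen L a b (dag X) *m X - dag X *m Gen L a b X.

Definition lindblad (H : M) (L : nat -> M) (a b : nat) (rho : M) : M :=
  - ('i)%C *: opcomm H rho +
  \sum_(a <= k < b) (L k *m rho *m dag (L k)
                     - 2^-1 *: (dag (L k) *m L k *m rho)
                     - 2^-1 *: (rho *m dag (L k) *m L k)).

Definition solves_lindblad (H : M) (L : nat -> M) (a b : nat) (rho : R -> M) :
  Prop :=
  forall (t : R) (i j : 'I_dim),
    is_derive t 1 (fun s => complex.Re (rho s i j)) (complex.Re (lindblad H L a b (rho t) i j)) /\
    is_derive t 1 (fun s => complex.Im (rho s i j)) (complex.Im (lindblad H L a b (rho t) i j)).

Definition ag_stable (H : M) (L : nat -> M) (a b : nat) (X : M) : Prop :=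
  forall d : R, min_eig X d ->
  forall rho : R -> M, is_density (rho 0) -> solves_lindblad H L a b rho ->
    (complex.Re (\tr (X *m rho t)) @[t --> +oo] --> d) /\
    (complex.Im (\tr (X *m rho t)) @[t --> +oo] --> (0 : R)).

Definition Wtil (W : nat -> M) (n : nat) : M := \sum_(1 <= l < n.+1) W l.

End Defs.

(* Main.v *)
Require Import Defs.
From HB Require Import structures.
From mathcomp Require Import all_boot all_order all_algebra.
From mathcomp Require Import all_classical all_reals all_analysis.
From mathcomp Require Import complex sesquilinear spectral ring lra.
Import Order.TTheory GRing.Theory Num.Theory.
Import numFieldNormedType.Exports.
Set Implicit Arguments.
Unset Strict Implicit.
Unset Printing Implicit Defensive.
Local Open Scope ring_scope.

(** Put [V = Wtil (n+1) - d (n+1)].  Since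
    [D(X + Y) = D(X) + D(Y) + 2 sum_k Re ([L_k^*, X] [Y, L_k])], the hypotheses
    add up to [G(V) <= 0] and [D(V) >= c V].  With [P = - G(V)] and
    [Y = s V - V^2], one has [- G(Y) = s P + D(V) - P V - V P].  Completing the
    square in [(s - V) P (s - V) >= 0] and using [P <= p] and [V^2 <= q V] gives
    [G(Y) <= - (c/2) V] and [V <= Y <= s V] for [s] large, so [tr (Y rho_t)],
    hence [tr (V rho_t)], decays exponentially.

    Positivity of [rho_t] comes from the completely positive map
    [sigma |-> (1 + h K) sigma (1 + h K)^* + h sum_k L_k sigma L_k^*], with
    [K = - i H - (1/2) sum_k L_k^* L_k], which agrees with the flow to first
    order in [h]; continuous induction on [rho_t + eps e^(lam t) >= 0] then
    applies, and [eps] tends to [0]. *)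

(** * Adjoints, positive semidefinite operators and the spectral theorem *)

Section Operators.
Context {R : realType} {dim : nat}.
Local Notation C := (R[i]).
Local Notation M := ('M[C]_dim).
Implicit Types (A B X Y V P : M) (v : 'cV[C]_dim).

Lemma dagK m n (A : 'M[C]_(m, n)) : dag (dag A) = A.
Proof. by apply/matrixP => i j; rewrite !mxE conjCK. Qed.

Lemma dagM m n p (A : 'M[C]_(m, n)) (B : 'M[C]_(n, p)) :
  dag (A *m B) = dag B *m dag A.
Proof. by rewrite /dag map_mxM trmx_mul. Qed.

Lemma dagD m n (A B : 'M[C]_(m, n)) : dag (A + B) = dag A + dag B.
Proof. by apply/matrixP => i j; rewrite !mxE rmorphD. Qed.

Lemma dagN m n (A : 'M[C]_(m, n)) : dag (- A) = - dag A.
Proof. by apply/matrixP => i j; rewrite !mxE rmorphN. Qed.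

Lemma dag0 m n : dag (0 : 'M[C]_(m, n)) = 0.
Proof. by apply/matrixP => i j; rewrite !mxE rmorph0. Qed.

Lemma dagZ m n (a : C) (A : 'M[C]_(m, n)) : dag (a *: A) = Num.conj a *: dag A.
Proof. by apply/matrixP => i j; rewrite !mxE rmorphM. Qed.

Lemma dag_sum m n (I : Type) (r : seq I) (Q : pred I) (F : I -> 'M[C]_(m, n)) :
  dag (\sum_(i <- r | Q i) F i) = \sum_(i <- r | Q i) dag (F i).
Proof. by apply: (big_morph (@dag R m n)); [exact: dagD | exact: dag0]. Qed.

Lemma dag_real_scalar (a : R) : dag ((a%:C)%C%:M : M) = ((a%:C)%C)%:M.
Proof.
apply/matrixP => i j; rewrite !mxE rmorphMn eq_sym; congr (_ *+ _).
exact: conjc_real.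
Qed.

Lemma dagZr m n (a : R) (A : 'M[C]_(m, n)) :
  dag ((a%:C)%C *: A) = (a%:C)%C *: dag A.
Proof. by rewrite dagZ; congr (_ *: _); exact: conjc_real. Qed.

(** The form condition of [is_psd] alone: this is what is carried from [rho 0] to [rho t], and what
    the trace inequality asks of a state. *)
Definition pos_form (A : M) : Prop :=
  forall v, 0 <= (dag v *m A *m v) 0 0.

Lemma is_psdD A B : is_psd A -> is_psd B -> is_psd (A + B).
Proof.
move=> [hA pA] [hB pB]; split; first by rewrite /is_herm dagD hA hB.
by move=> v; rewrite mulmxDr mulmxDl mxE addr_ge0.
Qed.

Lemma is_psdZ (a : R) A : 0 <= a -> is_psd A -> is_psd ((a%:C)%C *: A).
Proof.
move=> a0 [hA pA]; split; first by rewrite /is_herm dagZr hA.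
by move=> v; rewrite -scalemxAr -scalemxAl mxE mulr_ge0// ler0c.
Qed.

Lemma is_psd_congr A B : is_psd A -> is_psd (dag B *m A *m B).
Proof.
move=> [hA pA]; split; first by rewrite /is_herm !dagM dagK hA mulmxA.
by move=> v; have := pA (B *m v); rewrite dagM !mulmxA.
Qed.

Lemma is_psd0 : is_psd (0 : M).
Proof.
split; first by rewrite /is_herm dag0.
by move=> v; rewrite mulmx0 mul0mx mxE.
Qed.

Lemma is_psd_sum (I : Type) (r : seq I) (F : I -> M) :
  (forall i, is_psd (F i)) -> is_psd (\sum_(i <- r) F i).
Proof.
by move=> pF; apply: big_ind => //; [exact: is_psd0 | exact: is_psdD].
Qed.

Lemma is_psd_dag_mul A : is_psd (dag A *m A).
Proof.
split; first by rewrite /is_herm dagM dagK.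
move=> v; rewrite mulmxA -mulmxA -dagM mxE sumr_ge0// => i _.
by rewrite !mxE mulrC mul_conjC_ge0.
Qed.

(** Eigenvalues are kept as a real function of the index, so that an operator inequality between
    polynomials in one hermitian operator becomes a pointwise real inequality. *)
Definition rdiag (D : 'I_dim -> R) : M := diag_mx (\row_i (((D i)%:C)%C)).

Lemma herm_spectral A : is_herm A ->
  exists (U : M) (D : 'I_dim -> R),
    [/\ U *m dag U = 1%:M, dag U *m U = 1%:M & A = dag U *m rdiag D *m U].
Proof.
move=> hA.
have hsA : A \is hermsymmx.
  by rewrite is_hermitianmxE expr0 scale1r -map_trmx; apply/eqP; rewrite -[LHS]hA.
have uU : spectralmx A \is unitarymx by exact: spectral_unitarymx.
have UU : spectralmx A *m dag (spectralmx A) = 1%:M.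
  by move/unitarymxP: uU; rewrite -map_trmx.
exists (spectralmx A), (fun i => complex.Re (spectral_diag A 0 i)); split => //.
  exact: mulmx1C.
have /orthomx_spectralP {1}-> : A \is normalmx by exact: hermitian_normalmx.
rewrite (invmx_unitary uU) -map_trmx; congr (_ *m diag_mx _ *m _); apply/rowP => i; rewrite mxE; apply/esym/RRe_real.
exact: (mxOverP (hermitian_spectral_diag_real hsA)).
Qed.

Lemma rdiag_is_psd (D : 'I_dim -> R) : (forall i, 0 <= D i) -> is_psd (rdiag D).
Proof.
move=> D0; split.
  apply/matrixP => i j; rewrite !mxE rmorphMn; rewrite eq_sym.
  by case: eqP => [->|]; rewrite ?mulr0n// !mulr1n; exact: conjc_real.
move=> v; rewrite /rdiag mul_mx_diag mxE sumr_ge0// => i _; rewrite !mxE.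
by rewrite mulrAC mulrC mulr_ge0 ?ler0c// mulrC mul_conjC_ge0.
Qed.

(** Testing the form on [U^* e_i] returns exactly [D i]. *)
Lemma rdiag_psd_ge0 (U : M) (D : 'I_dim -> R) : U *m dag U = 1%:M ->
  is_psd (dag U *m rdiag D *m U) -> forall i, 0 <= D i.
Proof.
move=> UU [_ h] i; move: (h (dag U *m delta_mx i 0)).
rewrite dagM dagK !mulmxA -[_ *m U *m dag U]mulmxA UU mulmx1.
rewrite -[_ *m U *m dag U]mulmxA UU mulmx1.
rewrite -!mulmxA -colE mxE (bigD1 i)//= big1 ?addr0; last first.
  by move=> k /negPf ki; rewrite !mxE ki/= conjC0 mul0r.
by rewrite !mxE !eqxx/= conjC1 mul1r mulr1n ler0c.
Qed.

Lemma rdiag_scalar (a : R) : rdiag (fun=> a) = ((a%:C)%C)%:M.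
Proof. by apply/matrixP => i j; rewrite !mxE. Qed.

Lemma rdiagB (D E : 'I_dim -> R) :
  rdiag (fun i => D i - E i) = rdiag D - rdiag E.
Proof.
by apply/matrixP => i j; rewrite !mxE rmorphB mulrnBl.
Qed.

Lemma rdiagM (D E : 'I_dim -> R) :
  rdiag (fun i => D i * E i) = rdiag D *m rdiag E.
Proof.
rewrite /rdiag mulmx_diag; congr diag_mx; apply/rowP => i.
by rewrite !mxE rmorphM.
Qed.

Lemma psd_sqr_le A : is_psd A ->
  exists2 q : R, 0 < q & is_psd ((q%:C)%C *: A - A *m A).
Proof.
move=> pA; have [U [D [UU U'U defA]]] := herm_spectral (proj1 pA).
have D0 : forall i, 0 <= D i by apply: (@rdiag_psd_ge0 U) => //; rewrite -defA.
(* The sum dominates every nonnegative [D i]; the added 1 keeps [q] positive when all of them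
   vanish. *)
exists (1 + \sum_i D i); first by rewrite ltr_pwDl// sumr_ge0.
set q := 1 + _.
have -> : (q%:C)%C *: A - A *m A =
    dag U *m rdiag (fun i => q * D i - D i * D i) *m U.
  rewrite (rdiagB (fun i => q * D i)) (rdiagM (fun=> q)) rdiagM rdiag_scalar.
  rewrite mul_scalar_mx mulmxBr mulmxBl -scalemxAr -scalemxAl -defA.
  congr (_ - _); rewrite {1 2}defA -!mulmxA; congr (_ *m (_ *m _)).
  by rewrite !mulmxA UU mul1mx.
apply/is_psd_congr/rdiag_is_psd => i.
rewrite -mulrBl mulr_ge0// subr_ge0 /q (bigD1 i)//= addrCA ler_wpDr//.
by rewrite addr_ge0// sumr_ge0.
Qed.

Lemma herm_le_scalar A : is_herm A ->
  exists2 p : R, 0 < p & is_psd (((p%:C)%C)%:M - A).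
Proof.
move=> hA; have [U [D [UU U'U defA]]] := herm_spectral hA.
exists (1 + \sum_i `|D i|); first by rewrite ltr_pwDl// sumr_ge0.
set p := 1 + _.
have -> : ((p%:C)%C)%:M - A = dag U *m rdiag (fun i => p - D i) *m U.
  rewrite rdiagB rdiag_scalar mulmxBr mulmxBl -defA.
  by rewrite mul_mx_scalar -scalemxAl U'U scalemx1.
apply/is_psd_congr/rdiag_is_psd => i.
rewrite subr_ge0 (le_trans (ler_norm _))// /p (bigD1 i)//= addrCA lerDl.
by rewrite addr_ge0// sumr_ge0.
Qed.

(** Each diagonal entry [D i] is itself an eigenvalue. Since [eigenvalue] refers to row vectors, the
    eigenvector is row [i] of [U], which is nonzero because [U U^* = 1]. *)
Lemma eigenvalue_ge_psd A (d : R) : is_herm A ->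
  (forall a : C, eigenvalue A a -> (d%:C)%C <= a) ->
  is_psd (A - ((d%:C)%C)%:M).
Proof.
move=> hA ge_d; have [U [D [UU U'U defA]]] := herm_spectral hA.
have -> : A - ((d%:C)%C)%:M = dag U *m rdiag (fun i => D i - d) *m U.
  rewrite rdiagB rdiag_scalar mulmxBr mulmxBl -defA.
  by rewrite mul_mx_scalar -scalemxAl U'U scalemx1.
apply/is_psd_congr/rdiag_is_psd => i; rewrite subr_ge0 -lecR; apply: ge_d.
apply/eigenvalueP; exists (row i U).
  rewrite defA !mulmxA -row_mul UU -row_mul mul1mx row_diag_mx.
  by rewrite -scalemxAl -rowE mxE.
apply/negP => /eqP ri0.
have : row i (U *m dag U) = 0 by rewrite row_mul ri0 mul0mx.
rewrite UU => /rowP/(_ i); rewrite !mxE eqxx => /eqP.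
by rewrite oner_eq0.
Qed.

(** In an eigenbasis of [A] the trace is the sum of the eigenvalues weighted by the form of [rho] on
    the eigenvectors. *)
Lemma mxtrace_psd_ge0 A rho : is_psd A -> pos_form rho -> 0 <= \tr (A *m rho).
Proof.
move=> pA prho; have [U [D [UU U'U defA]]] := herm_spectral (proj1 pA).
have D0 : forall i, 0 <= D i by apply: (@rdiag_psd_ge0 U) => //; rewrite -defA.
rewrite defA -!mulmxA mxtrace_mulC -!mulmxA mul_diag_mx /mxtrace.
rewrite sumr_ge0// => i _; rewrite mxE [X in X * _]mxE mulr_ge0 ?ler0c//.
have -> : (U *m (rho *m dag U)) i i = (row i U *m rho *m dag (row i U)) 0 0.
  rewrite -mulmxA [LHS]mxE [RHS]mxE; apply: eq_bigr => k _.
  rewrite [in RHS]mxE; congr (_ * _); rewrite !mxE; apply: eq_bigr => l _.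
  by rewrite !mxE.
by have := prho (dag (row i U)); rewrite dagK.
Qed.

End Operators.

(* Noncommutative identities in ['M_dim]: expand, abstract the monomials, and
   compare entrywise. *)
Ltac mx_expand :=
  rewrite ?(mulmxDl, mulmxDr, mulmxBl, mulmxBr, mulNmx, mulmxN,
            mul_scalar_mx, mul_mx_scalar);
  rewrite -?(scalemxAl, scalemxAr) ?mulmxA.
Ltac mx_field :=
  repeat match goal with |- context [@mulmx ?S ?m ?n ?p ?A ?B] =>
    move: (@mulmx S m n p A B) => ? end;
  apply/matrixP => ? ?; rewrite !mxE; field.

(** * Generator, dissipation and the Lyapunov operator *)

Section Generators.
Context {R : realType} {dim : nat}.
Local Notation C := (R[i]).
Local Notation M := ('M[C]_dim).
Implicit Types (A B X Y V P J rho : M) (L : nat -> M).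

Lemma GenL_linear J (a : C) X Y : GenL J (a *: X + Y) = a *: GenL J X + GenL J Y.
Proof. by rewrite /GenL; move: (dag J) => J'; mx_expand; mx_field. Qed.

Lemma GenL_scalar J (a : C) : GenL J (a%:M) = 0.
Proof. by rewrite /GenL; move: (dag J) => J'; mx_expand; mx_field. Qed.

(** The defect of the Leibniz rule for one coupling. For hermitian [X] the first commutator is the
    adjoint of the second, so the defect has the shape [Z^* Z]. *)
Lemma GenL_leibniz J X :
  GenL J (X *m X) - GenL J X *m X - X *m GenL J X =
  opcomm (dag J) X *m opcomm X J.
Proof.
by rewrite /GenL /opcomm; move: (dag J) => J'; mx_expand; mx_field.
Qed.

Lemma Gen_linear L i j (a : C) X Y :
  Gen L i j (a *: X + Y) = a *: Gen L i j X + Gen L i j Y.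
Proof.
rewrite /Gen scaler_sumr -big_split; apply: eq_bigr => k _.
exact: GenL_linear.
Qed.

Lemma Gen_scalar L i j (a : C) : Gen L i j (a%:M) = 0.
Proof. by rewrite /Gen big1// => k _; rewrite GenL_scalar. Qed.

Lemma GenZ L i j (a : C) X : Gen L i j (a *: X) = a *: Gen L i j X.
Proof.
have := Gen_scalar L i j 0; rewrite (raddf0 (@scalar_mx C dim)) => G0.
by rewrite -[a *: X]addr0 Gen_linear G0 addr0.
Qed.

Lemma GenD L i j X Y : Gen L i j (X + Y) = Gen L i j X + Gen L i j Y.
Proof. by rewrite -{1}[X]scale1r Gen_linear scale1r. Qed.

Lemma GenB L i j X Y : Gen L i j (X - Y) = Gen L i j X - Gen L i j Y.
Proof. by rewrite GenD -scaleN1r GenZ scaleN1r. Qed.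

Lemma Diss_herm L i j X : is_herm X ->
  Diss L i j X = \sum_(i <= k < j) opcomm (dag (L k)) X *m opcomm X (L k).
Proof.
move=> hX; rewrite /Diss hX /Gen mulmx_suml mulmx_sumr -!sumrB.
by apply: eq_bigr => k _; rewrite GenL_leibniz.
Qed.

Lemma opcommDl A B J : opcomm (A + B) J = opcomm A J + opcomm B J.
Proof. by rewrite /opcomm; mx_expand; mx_field. Qed.

Lemma opcommDr A B J : opcomm J (A + B) = opcomm J A + opcomm J B.
Proof. by rewrite /opcomm; mx_expand; mx_field. Qed.

Lemma opcomm_shiftl X J (a : C) : opcomm (X - a%:M) J = opcomm X J.
Proof. by rewrite /opcomm; mx_expand; mx_field. Qed.

Lemma opcomm_shiftr X J (a : C) : opcomm J (X - a%:M) = opcomm J X.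
Proof. by rewrite /opcomm; mx_expand; mx_field. Qed.

Lemma herm_shift X (a : R) : is_herm X -> is_herm (X - ((a%:C)%C)%:M).
Proof. by move=> hX; rewrite /is_herm dagD dagN hX dag_real_scalar. Qed.

Lemma Diss_shift L i j X (a : R) : is_herm X ->
  Diss L i j (X - ((a%:C)%C)%:M) = Diss L i j X.
Proof.
move=> hX; rewrite !Diss_herm//; last exact: herm_shift.
by apply: eq_bigr => k _; rewrite opcomm_shiftl opcomm_shiftr.
Qed.

Lemma dag_opcomm A B : dag (opcomm A B) = opcomm (dag B) (dag A).
Proof. by rewrite /opcomm dagD dagN !dagM. Qed.

(** This lets the couplings [M+1..K], about which nothing is assumed for [Wtil W n] alone, enter its
    dissipation with a favourable sign. *)
Lemma Diss_psd L i j X : is_herm X -> is_psd (Diss L i j X).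
Proof.
move=> hX; rewrite Diss_herm//; apply: is_psd_sum => k.
have <- : dag (opcomm X (L k)) = opcomm (dag (L k)) X by rewrite dag_opcomm hX.
exact: is_psd_dag_mul.
Qed.

(** Polarisation: the two cross terms of each coupling are adjoint to each other, so they add up to
    twice a real part. *)
Lemma Diss_add L i j X Y : is_herm X -> is_herm Y ->
  Diss L i j (X + Y) = Diss L i j X + Diss L i j Y
   + 2%:R *: \sum_(i <= k < j) ReOp (opcomm (dag (L k)) X *m opcomm Y (L k)).
Proof.
move=> hX hY; rewrite !Diss_herm//; last by rewrite /is_herm dagD hX hY.
rewrite scaler_sumr -!big_split; apply: eq_bigr => k _ /=.
rewrite /ReOp dagM !dag_opcomm hX hY dagK.
rewrite opcommDl opcommDr.
move: (opcomm (dag (L k)) X) (opcomm (dag (L k)) Y) (opcomm X (L k))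
  (opcomm Y (L k)) => a b c e.
by mx_expand; mx_field.
Qed.

(** With [P = - G(V)] and [D = D(V)] the left side is [- G(Y) - k Y] for [Y = s V - V^2]. The right
    side is arranged so that every summand is positive semidefinite once [P <= p], [V^2 <= q V] and
    the scalar coefficient of [V] is nonnegative. *)
Lemma lyapunov_identity (s k c p q : C) V P D : s != 0 ->
  s *: P + (D - P *m V - V *m P) - k *: (s *: V - V *m V) =
  (D - c *: V) + s^-1 *: ((s%:M - V) *m P *m (s%:M - V))
  + s^-1 *: (V *m (p%:M - P) *m V) + (p / s) *: (q *: V - V *m V)
  + (c - p * q / s - k * s) *: V + k *: (V *m V).
Proof. by move=> s0; mx_expand; mx_field. Qed.

(* The term [- P V - V P] of [G(V^2)] is absorbed by completing the square
   [(s - V) P (s - V) >= 0], at the price of [V P V / s], which is small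
   compared with [V] for large [s]. *)
Lemma lyapunov_exists L i j V (c : R) : 0 < c -> is_psd V ->
  is_psd (- Gen L i j V) -> is_psd (Diss L i j V - (c%:C)%C *: V) ->
  exists s k : R, let Y := (s%:C)%C *: V - V *m V in
   [/\ 0 < k, is_psd (Y - V) & is_psd (- Gen L i j Y - (k%:C)%C *: Y)].
Proof.
have [P GV] : exists P, Gen L i j V = - P by exists (- Gen L i j V); rewrite opprK.
rewrite GV opprK => c0 pV pP pD.
have [p p0 pp] := herm_le_scalar (proj1 pP).
have [q q0 pq] := psd_sqr_le pV.
have pV2 : is_psd (V *m V) by rewrite -{1}(proj1 pV); exact: is_psd_dag_mul.
have [s [k [s0 k0 sq ck]]] : exists s k : R,
    [/\ 0 < s, 0 < k, 0 <= s - q - 1 & 0 <= c - p * q / s - k * s].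
  have pqc : 0 < 2 * p * q / c by rewrite divr_gt0// !mulr_gt0.
  (* The first term of [s] forces [p q / s <= c / 2], the rest gives [s >= q + 1] and hence
     [V <= Y]. The choice of [k] below spends the other half, [k s = c / 2]. *)
  pose s := 2 * p * q / c + q + 1.
  have s0 : 0 < s by rewrite /s; lra.
  exists s, (c / (2 * s)); split => //.
  - by rewrite divr_gt0// mulr_gt0.
  - by rewrite /s; lra.
  have -> : c - p * q / s - c / (2 * s) * s = (c / 2 * s - p * q) / s.
    by field; rewrite gt_eqF.
  rewrite divr_ge0// ?(ltW s0)// subr_ge0.
  have -> : c / 2 * s = p * q + c / 2 * (q + 1).
    by rewrite /s; field; rewrite gt_eqF.
  by rewrite lerDl mulr_ge0//; lra.
exists s, k; cbv zeta; split; first exact: k0.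
  have -> : (s%:C)%C *: V - V *m V - V =
      ((q%:C)%C *: V - V *m V) + ((s - q - 1)%:C)%C *: V.
    by rewrite !rmorphB rmorph1; move: (V *m V) => Z; apply/matrixP => x y;
      rewrite !mxE; ring.
  exact: is_psdD pq (is_psdZ sq pV).
have GV2 : Gen L i j (V *m V) = Diss L i j V - P *m V - V *m P.
  by rewrite /Diss (proj1 pV) GV; mx_expand; mx_field.
rewrite GenB GenZ GV GV2 opprB scalerN opprK [X in X - _]addrC.
have sC : (s%:C)%C != 0 :> C by rewrite fmorph_eq0 gt_eqF.
rewrite (lyapunov_identity _ (c%:C)%C (p%:C)%C (q%:C)%C _ _ _ sC).
rewrite -fmorphV -!rmorphM -!rmorphB /=.
have hs : dag ((s%:C)%C%:M - V) = (s%:C)%C%:M - V.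
  by rewrite dagD dagN dag_real_scalar (proj1 pV).
have si0 : 0 <= s^-1 by rewrite invr_ge0 ltW.
have psi0 : 0 <= p * s^-1 by rewrite mulr_ge0// ltW.
have pPs := is_psd_congr ((s%:C)%C%:M - V) pP; rewrite hs in pPs.
have pPp := is_psd_congr V pp; rewrite (proj1 pV) in pPp.
apply: is_psdD; last exact: is_psdZ (ltW k0) pV2.
apply: is_psdD; last exact: is_psdZ ck pV.
apply: is_psdD; last exact: is_psdZ psi0 pq.
apply: is_psdD; last exact: is_psdZ si0 pPp.
exact: is_psdD pD (is_psdZ si0 pPs).
Qed.

(** Duality of the Schrödinger and Heisenberg pictures, by cyclicity of the trace; the Hamiltonian
    term drops out because [X] commutes with [H]. *)
Lemma mxtrace_lindblad H L i j X rho : X *m H = H *m X ->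
  \tr (X *m lindblad H L i j rho) = \tr (Gen L i j X *m rho).
Proof.
move=> XH; rewrite /lindblad mulmxDr raddfD/= -scalemxAr linearZ/=.
have -> : \tr (X *m opcomm H rho) = 0.
  rewrite /opcomm mulmxBr raddfB/= !mulmxA XH [X in _ - X]mxtrace_mulC mulmxA.
  by rewrite subrr.
rewrite mulr0 add0r mulmx_sumr /Gen mulmx_suml !raddf_sum; apply: eq_bigr => k _.
rewrite /GenL /=; mx_expand; rewrite !raddfB/= !mxtraceZ.
rewrite [RHS]addrAC; congr (_ - _ - _); first by rewrite mxtrace_mulC !mulmxA.
congr (_ * _).
by rewrite -[X *m rho *m _ *m _]mulmxA mxtrace_mulC !mulmxA.
Qed.

(** Generator of the evolution without jumps: [- i] times the effective Hamiltonian
    [H - (i/2) sum_k L_k^* L_k]. *)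
Definition drift H L i j : M :=
  - ('i)%C *: H - 2^-1 *: \sum_(i <= k < j) (dag (L k) *m L k).

(** Separates the drift from the jump terms, the form in which a completely positive Euler step can
    be recognised. *)
Lemma lindblad_drift H L i j rho : is_herm H ->
  lindblad H L i j rho = drift H L i j *m rho + rho *m dag (drift H L i j)
    + \sum_(i <= k < j) (L k *m rho *m dag (L k)).
Proof.
move=> hH.
have -> : dag (drift H L i j) =
    ('i)%C *: H - 2^-1 *: \sum_(i <= k < j) (dag (L k) *m L k).
  rewrite /drift !(dagD, dagN, dagZ) hH dag_sum.
  under eq_bigr do rewrite dagM dagK.
  have -> : Num.conj (2^-1 : C) = 2^-1 by rewrite fmorphV rmorph_nat.
  congr (_ *: _ - _); apply/eqP; rewrite eq_complex/= !oppr0 opprK !eqxx//.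
rewrite /lindblad !sumrB -!scaler_sumr -mulmx_suml.
under [X in _ - _ - _ *: X]eq_bigr do rewrite -mulmxA.
by rewrite -mulmx_sumr /drift /opcomm; mx_expand; mx_field.
Qed.

End Generators.

(** * Real analysis in one variable *)

Section RealLemmas.
Context {R : realType}.

(** If [P T] fails, the times up to which [P] holds throughout are bounded by [T]. Closedness gives
    [P] at their supremum, and openness then carries [P] beyond it. *)
Lemma continuous_induction (P : R -> Prop) :
  P 0 ->
  (forall t, 0 < t -> (forall s, 0 <= s < t -> P s) -> P t) ->
  (forall t, 0 <= t -> P t ->
     exists2 e, 0 < e & forall h, 0 <= h < e -> P (t + h)) ->
  forall t, 0 <= t -> P t.
Proof.
move=> P0 Pclosed Popen T T0; apply: contrapT => nPT.
pose S := [set t : R | 0 <= t /\ forall s, 0 <= s <= t -> P s]%classic.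
have S0 : S 0 by split=> // s /andP[s0 s1]; have -> : s = 0 by lra.
have ubT : ubound S T.
  move=> t [t0 Pt]; rewrite leNgt; apply/negP => Tt.
  by apply: nPT; apply: Pt; rewrite T0 ltW.
have supS : has_sup S by split; [exists 0 | exists T].
have s0 : 0 <= sup S by apply: (ub_le_sup (proj2 supS)).
have Plt s : 0 <= s < sup S -> P s.
  move=> /andP[s_ge0 /(sup_gt (proj1 supS))[t [t0 Pt] st]].
  by apply: Pt; rewrite s_ge0 ltW.
have Psup : P (sup S).
  have [->//|sn0] := eqVneq (sup S) 0.
  by apply: Pclosed => //; rewrite lt_neqAle eq_sym sn0.
have [e e0 Pe] := Popen _ s0 Psup.
have : S (sup S + e / 2).
  split; first by rewrite addr_ge0// divr_ge0// ltW.
  move=> s /andP[s_ge0 se]; have [lts|ges] := ltP s (sup S).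
    by apply: Plt; rewrite s_ge0.
  by rewrite -[s](subrKC (sup S)); apply: Pe; apply/andP; split; lra.
by move=> /(ub_le_sup (proj2 supS)); lra.
Qed.

(** The difference quotient estimate multiplied by [h], which makes it valid at [h = 0] as well. *)
Lemma is_derive_first_order (f : R -> R) (t df e : R) :
  is_derive t 1 f df -> 0 < e ->
  (\forall h \near (0 : R), `|f (t + h) - f t - h * df| <= e * `|h|).
Proof.
move=> [drv dfE] e0.
have /cvgr_dist_le/(_ e e0) : (h^-1 *: ((f \o shift t) (h *: 1) - f t)
    @[h --> 0^'] --> df)%classic by rewrite -dfE; exact: drv.
rewrite near_withinE; apply: filterS => h hP.
have [->|h0] := eqVneq h 0; first by rewrite addr0 subrr mul0r subrr normr0 mulr0.
have := hP h0; rewrite /= /shift /= scaler1 [h + t]addrC => {}hP.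
have -> : f (t + h) - f t - h * df = - h * (df - h^-1 * (f (t + h) - f t)).
  by field.
by rewrite normrM normrN mulrC ler_wpM2r.
Qed.

Lemma is_derive_continuous (f : R -> R) (t df : R) :
  is_derive t 1 f df -> {for t, continuous f}.
Proof.
by move=> [drv _]; apply/differentiable_continuous/derivable1_diffP.
Qed.

Lemma closed_ge0 (f : R -> R) (t : R) : 0 < t -> {for t, continuous f} ->
  (forall s, 0 <= s < t -> 0 <= f s) -> 0 <= f t.
Proof.
move=> t0 cf f0; rewrite leNgt; apply/negP => ft0.
have /nbhs_ballP[e/= e0 be] : \forall s \near t, f s < 0.
  exact: (cvgr_lt _ cf).
(* A point of [[0, t)] within [e] of [t]; the maximum keeps it nonnegative. *)
pose s := Num.max 0 (t - e / 2).
have s0 : 0 <= s by rewrite le_max lexx.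
have st : s < t by rewrite gt_max t0/= gtrBl divr_gt0.
have sge : t - e / 2 <= s by rewrite le_max lexx orbT.
have := f0 s; rewrite s0 st => /(_ isT); rewrite leNgt => /negP; apply.
apply: be; rewrite /ball/= ger0_norm; last by rewrite subr_ge0 ltW.
by lra.
Qed.

(** Contribution of one matrix entry [x + i y] to the form, with [a + i b] and [c + i d] two
    coordinates of the vector; it follows from [2 |a c| <= a^2 + c^2] and its analogues. *)
Lemma sesqui_entry_bound (e x y a b c d : R) : `|x| <= e -> `|y| <= e ->
  `|x * (a * c + b * d) - y * (a * d - b * c)|
    <= e * ((a ^+ 2 + b ^+ 2) + (c ^+ 2 + d ^+ 2)).
Proof.
move=> xe ye; have e0 : 0 <= e by exact: le_trans xe.
set N := (a ^+ 2 + b ^+ 2) + _.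
have h1 : `|a * c + b * d| <= N / 2.
  have := sqr_ge0 (a - c); have := sqr_ge0 (b - d).
  have := sqr_ge0 (a + c); have := sqr_ge0 (b + d).
  by rewrite ler_norml /N => ? ? ? ?; apply/andP; split; nra.
have h2 : `|a * d - b * c| <= N / 2.
  have := sqr_ge0 (a - d); have := sqr_ge0 (b - c).
  have := sqr_ge0 (a + d); have := sqr_ge0 (b + c).
  by rewrite ler_norml /N => ? ? ? ?; apply/andP; split; nra.
rewrite (le_trans (ler_normB _ _))// !normrM.
have -> : e * N = e * (N / 2) + e * (N / 2) by field.
by rewrite lerD// ler_pM.
Qed.

End RealLemmas.

(** * Quadratic forms of complex matrices and their bounds *)

Section Positivity.
Context {R : realType} {dim : nat}.
Local Notation C := (R[i]).
Local Notation M := ('M[C]_dim).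
Implicit Types (A B X Y K : M) (v : 'cV[C]_dim).

(** A real number, real-linear in [A], for every matrix [A]; the imaginary part of the form is
    reached later through [i A]. *)
Definition re_form A v : R := complex.Re ((dag v *m A *m v) 0 0).

Lemma ReD (x y : C) : complex.Re (x + y) = complex.Re x + complex.Re y.
Proof. by case: x y => ? ? [? ?]. Qed.

Lemma ReZ (a : R) (x : C) : complex.Re ((a%:C)%C * x) = a * complex.Re x.
Proof. by case: x => ? ? /=; rewrite mul0r subr0. Qed.

Lemma Re_sum (I : Type) (r : seq I) (F : I -> C) :
  complex.Re (\sum_(i <- r) F i) = \sum_(i <- r) complex.Re (F i).
Proof. by apply: (big_morph (@complex.Re R)) => //; exact: ReD. Qed.

Lemma re_formD A B v : re_form (A + B) v = re_form A v + re_form B v.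
Proof. by rewrite /re_form mulmxDr mulmxDl mxE ReD. Qed.

Lemma re_formZ (a : R) A v : re_form ((a%:C)%C *: A) v = a * re_form A v.
Proof. by rewrite /re_form -scalemxAr -scalemxAl mxE ReZ. Qed.

Lemma re_formB A B v : re_form (A - B) v = re_form A v - re_form B v.
Proof.
have -> : - B = ((-1)%:C)%C *: B by rewrite rmorphN1 scaleN1r.
by rewrite re_formD re_formZ mulN1r.
Qed.

Lemma re_form_sum (I : Type) (r : seq I) (F : I -> M) v :
  re_form (\sum_(i <- r) F i) v = \sum_(i <- r) re_form (F i) v.
Proof.
apply: (big_morph (re_form^~ v)) => [A B|]; first exact: re_formD.
by rewrite /re_form mulmx0 mul0mx mxE.
Qed.

Lemma re_form_congr A B v : re_form (B *m A *m dag B) v = re_form A (dag B *m v).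
Proof. by rewrite /re_form dagM dagK !mulmxA. Qed.

(** The form is an expectation of the rank-one operator [v v^*], so the equation tested against
    operators governs its evolution. *)
Lemma re_form_mxtrace A v : re_form A v = complex.Re (\tr ((v *m dag v) *m A)).
Proof. by rewrite /re_form -trace_mx11 mxtrace_mulC !mulmxA. Qed.

Lemma re_form_expand A v : re_form A v = \sum_i \sum_j
  (complex.Re (A i j) * (complex.Re (v i 0) * complex.Re (v j 0)
                         + complex.Im (v i 0) * complex.Im (v j 0))
   - complex.Im (A i j) * (complex.Re (v i 0) * complex.Im (v j 0)
                         - complex.Im (v i 0) * complex.Re (v j 0))).
Proof.
rewrite /re_form mxE Re_sum exchange_big/=; apply: eq_bigr => j _.
rewrite mxE mulr_suml Re_sum; apply: eq_bigr => i _; rewrite !mxE.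
by case: (v i 0) (v j 0) (A i j) => [a b] [c d] [x y] /=; ring.
Qed.

Definition sqnorm v : R := \sum_i (complex.Re (v i 0) ^+ 2 + complex.Im (v i 0) ^+ 2).

Lemma sqnorm_ge0 v : 0 <= sqnorm v.
Proof. by rewrite sumr_ge0// => i _; rewrite addr_ge0// sqr_ge0. Qed.

Lemma re_form_scalar (a : R) v : re_form (((a%:C)%C)%:M) v = a * sqnorm v.
Proof.
rewrite re_form_expand mulr_sumr; apply: eq_bigr => i _.
rewrite (bigD1 i)//= big1 ?addr0; last first.
  by move=> j /negPf ji; rewrite !mxE eq_sym ji mulr0n/= !mul0r subr0.
by rewrite !mxE eqxx mulr1n/=; ring.
Qed.

(** In the double sum each squared coordinate occurs [dim] times through the row index and [dim]
    times through the column index, whence the factor [2 dim]. *)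
Lemma re_form_entry_bound A v (e : R) :
  (forall i j, `|complex.Re (A i j)| <= e /\ `|complex.Im (A i j)| <= e) ->
  `|re_form A v| <= 2 * dim%:R * e * sqnorm v.
Proof.
move=> Ae; rewrite re_form_expand.
rewrite (le_trans (ler_norm_sum _ _ _))//.
have -> : 2 * dim%:R * e * sqnorm v = \sum_(i < dim) \sum_(j < dim) (e *
   ((complex.Re (v i 0) ^+ 2 + complex.Im (v i 0) ^+ 2) +
    (complex.Re (v j 0) ^+ 2 + complex.Im (v j 0) ^+ 2))).
  under eq_bigr do rewrite -mulr_sumr big_split/= sumr_const card_ord -/(sqnorm v).
  rewrite -mulr_sumr big_split/= sumr_const card_ord.
  by rewrite sumrMnl -/(sqnorm v) -mulr_natl; ring.
apply: ler_sum => i _; rewrite (le_trans (ler_norm_sum _ _ _))//.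
by apply: ler_sum => j _; have [? ?] := Ae i j; exact: sesqui_entry_bound.
Qed.

Lemma re_form_bounded A : exists2 b : R, 0 <= b &
  forall v, `|re_form A v| <= b * sqnorm v.
Proof.
pose e := \sum_i \sum_j (`|complex.Re (A i j)| + `|complex.Im (A i j)|).
exists (2 * dim%:R * e).
  apply: mulr_ge0; first exact: mulr_ge0.
  by apply: sumr_ge0 => i _; apply: sumr_ge0 => j _; exact: addr_ge0.
move=> v; apply: re_form_entry_bound => i j.
have : `|complex.Re (A i j)| + `|complex.Im (A i j)| <= e.
  rewrite /e (bigD1 i)//= (bigD1 j)//= -addrA lerDl; apply: addr_ge0.
    by apply: sumr_ge0 => k _; exact: addr_ge0.
  by apply: sumr_ge0 => k _; apply: sumr_ge0 => l _; exact: addr_ge0.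
by move=> le_e; split; apply: le_trans le_e; rewrite ?lerDl ?lerDr.
Qed.

End Positivity.

(** * Positivity of the Lindblad flow *)

Section Evolution.
Context {R : realType} {dim : nat}.
Local Notation C := (R[i]).
Local Notation M := ('M[C]_dim).
Implicit Types (A B X Y K H : M) (L : nat -> M) (rho : R -> M).

(** Real parts suffice, since [X] ranges over all complex matrices and may be multiplied by [- i]. A
    complex factor on [rho] can likewise be moved onto [X]. *)
Definition weak_solution H L i j rho : Prop :=
  forall X (t : R), is_derive t 1 (fun s => complex.Re (\tr (X *m rho s)))
                      (complex.Re (\tr (X *m lindblad H L i j (rho t)))).

Lemma Re_mxtrace_mul X Y : complex.Re (\tr (X *m Y)) =
  \sum_(i < dim) \sum_(j < dim) (complex.Re (X i j) * complex.Re (Y j i)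
     - complex.Im (X i j) * complex.Im (Y j i)).
Proof.
rewrite /mxtrace Re_sum; apply: eq_bigr => i _.
rewrite mxE Re_sum; apply: eq_bigr => j _.
by case: (X i j) (Y j i) => [a b] [c d].
Qed.

Lemma solves_lindblad_weak H L i j rho :
  solves_lindblad H L i j rho -> weak_solution H L i j rho.
Proof.
move=> sol X t; rewrite Re_mxtrace_mul.
have -> : (fun s => complex.Re (\tr (X *m rho s))) =
  \sum_(k < dim) \sum_(l < dim)
    ((complex.Re (X k l) \*: (fun s => complex.Re (rho s l k)))
     - (complex.Im (X k l) \*: (fun s => complex.Im (rho s l k)))).
  apply/funext => s; rewrite Re_mxtrace_mul fct_sumE; apply: eq_bigr => k _.
  by rewrite fct_sumE.
apply: is_derive_sum => k; apply: is_derive_sum => l.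
by have [? ?] := sol t l k; apply: is_deriveB; exact: is_deriveZ.
Qed.

Lemma lindbladZ H L i j (a : C) Y :
  lindblad H L i j (a *: Y) = a *: lindblad H L i j Y.
Proof.
rewrite /lindblad [RHS]scalerDr scaler_sumr; congr (_ + _).
  by rewrite /opcomm; mx_expand; mx_field.
apply: eq_bigr => k _; move: (L k) (dag (L k)) => J J'.
by mx_expand; mx_field.
Qed.

Lemma weak_solutionZ H L i j rho (a : C) : weak_solution H L i j rho ->
  weak_solution H L i j (fun t => a *: rho t).
Proof.
move=> sol X t; have := sol (a *: X) t.
rewrite lindbladZ -scalemxAr -scalemxAl.
by under eq_fun do rewrite -scalemxAl scalemxAr.
Qed.

(** Regularising the state by [a] times the identity changes its velocity by [a] times a fixed
    matrix, whose form bound will determine the growth rate [lam]. *)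
Lemma lindblad_shift H L i j (a : C) Y : is_herm H ->
  lindblad H L i j (Y + a%:M) = lindblad H L i j Y + a *: lindblad H L i j 1%:M.
Proof.
move=> hH; rewrite !lindblad_drift//; move: (drift _ _ _ _) => K.
have -> : \sum_(i <= k < j) L k *m (Y + a%:M) *m dag (L k) =
    \sum_(i <= k < j) L k *m Y *m dag (L k)
    + a *: \sum_(i <= k < j) L k *m 1%:M *m dag (L k).
  rewrite scaler_sumr -big_split; apply: eq_bigr => k _ /=.
  by rewrite mulmxDr mulmxDl mul_mx_scalar mulmx1 -scalemxAl.
move: (dag K) => K'; rewrite !mulmx1 !mul1mx.
move: (\sum_(i <= k < j) _) (\sum_(i <= k < j) _) => S T.
by mx_expand; mx_field.
Qed.

(* The positive map on the left agrees with an Euler step of the Lindblad flow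
   up to second order in [h]. *)
Lemma euler_step H L i j (h : R) Y : is_herm H ->
  (1%:M + (h%:C)%C *: drift H L i j) *m Y
     *m dag (1%:M + (h%:C)%C *: drift H L i j)
   + (h%:C)%C *: \sum_(i <= k < j) (L k *m Y *m dag (L k)) =
  Y + (h%:C)%C *: lindblad H L i j Y
    + ((h ^+ 2)%:C)%C *: (drift H L i j *m Y *m dag (drift H L i j)).
Proof.
move=> hH; rewrite lindblad_drift// dagD dagZr.
have -> : dag (1%:M : M) = 1%:M by have := dag_real_scalar 1; rewrite rmorph1.
move: (drift _ _ _ _) => K; move: (dag K) => K'.
move: (\sum_(i <= k < j) _) => S; rewrite rmorphXn/=; move: (h%:C)%C => x.
by rewrite !(mulmxDl, mulmxDr, mul1mx, mulmx1); mx_expand; mx_field.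
Qed.

(** By [euler_step] the matrix is a congruence of [Y] plus a nonnegative multiple of a sum of
    congruences of [Y]. *)
Lemma euler_step_ge0 H L i j (h : R) Y v : is_herm H -> 0 <= h ->
  (forall w, 0 <= re_form Y w) ->
  0 <= re_form (Y + (h%:C)%C *: lindblad H L i j Y
    + ((h ^+ 2)%:C)%C *: (drift H L i j *m Y *m dag (drift H L i j))) v.
Proof.
move=> hH h0 Y0; rewrite -euler_step// re_formD re_formZ re_form_congr re_form_sum.
rewrite addr_ge0// mulr_ge0// sumr_ge0// => k _.
by rewrite re_form_congr.
Qed.

(** Differentiability is used only for the finitely many entries, so the neighbourhood of 0 does not
    depend on [v]. *)
Lemma weak_solution_first_order H L i j rho (t e : R) :
  weak_solution H L i j rho -> 0 < e ->
  \forall h \near (0 : R), forall v,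
   `|re_form (rho (t + h) - rho t - (h%:C)%C *: lindblad H L i j (rho t)) v|
     <= e * `|h| * sqnorm v.
Proof.
(* The added 1 keeps the denominator positive when [dim = 0]; what matters is [2 dim e' <= e]. *)
move=> sol e0; pose e' := e / (2 * dim%:R + 1).
have d0 : 0 <= dim%:R :> R by [].
have e'0 : 0 < e' by rewrite /e' divr_gt0//; lra.
have key (p : 'I_dim * 'I_dim) : \forall h \near (0 : R),
    let E := rho (t + h) - rho t - (h%:C)%C *: lindblad H L i j (rho t) in
    `|complex.Re (E p.1 p.2)| <= e' * `|h| /\ `|complex.Im (E p.1 p.2)| <= e' * `|h|.
  have trE (a : C) Y : \tr (a *: delta_mx p.2 p.1 *m Y) = a * Y p.1 p.2.
    rewrite -scalemxAl mxtraceZ; congr (_ * _); rewrite mxtrace_mulC.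
    rewrite /mxtrace (bigD1 p.1)//= big1 ?addr0; last first.
      move=> k /negPf kp; rewrite mxE big1// => l _.
      by rewrite mxE kp andbF mulr0.
    rewrite mxE (bigD1 p.2)//= big1 ?addr0; last first.
      by move=> k /negPf kp; rewrite mxE kp mulr0.
    by rewrite mxE !eqxx mulr1.
  (* The coefficients 1 and [- i] extract the real and imaginary parts, since
     [Re (- i z) = Im z]. *)
  have := is_derive_first_order (sol (1 *: delta_mx p.2 p.1) t) e'0.
  have := is_derive_first_order (sol (- ('i)%C *: delta_mx p.2 p.1) t) e'0.
  apply: filterS2 => h; rewrite !trE !mul1r.
  move: (rho (t + h)) (rho t) (lindblad _ _ _ _ _) => X Y A; rewrite !mxE.
  move: (A _ _) (X _ _) (Y _ _) => [x y] [a b] [c d] /=.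
  by rewrite !(mul0r, oppr0, mulN1r, opprK, sub0r, subr0, add0r, addr0).
apply: filterS (filter_forall _ key) => h hE v.
rewrite (le_trans (re_form_entry_bound _ (e := e' * `|h|) _))//.
  by move=> k l; exact: (hE (k, l)).
rewrite ler_wpM2r ?sqnorm_ge0// mulrA ler_wpM2r// /e' mulrCA ler_piMr ?(ltW e0)//.
by rewrite ler_pdivrMr; lra.
Qed.

(** Here [r0] and [r1] are the forms of the state at times [t] and [t + h], [s] is the
    regularisation at [t], [z1] the form of the generator applied to the identity, and [q] the
    second-order term. Of the loss [s (c2 + 1) h n], the part with [c2] pays for [z1], and the
    remaining unit is split equally between the derivative error and [q]. *)
Lemma euler_step_arith (s h n c1 c2 r0 r1 z z1 q E : R) :
  0 < s -> 0 <= h -> 0 <= n -> 0 <= c1 -> 0 <= c2 ->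
  `|r1 - r0 - h * z| <= s / 2 * h * n ->
  0 <= r0 + s * n + h * (z + s * z1) + h ^+ 2 * q ->
  `|q| <= c1 * n -> `|z1| <= c2 * n -> h * (c1 + 1) <= s / 2 ->
  s * (1 + (c2 + 1) * h) * n <= E -> 0 <= r1 + E.
Proof.
rewrite !ler_norml => s0 h0 n0 c10 c20 /andP[d1 _] eu /andP[_ q1] /andP[_ z1n] hs En.
have p1 : h * s * z1 <= h * s * (c2 * n) by rewrite ler_wpM2l// mulr_ge0// ltW.
have p2 : h ^+ 2 * q <= h ^+ 2 * (c1 * n) by rewrite ler_wpM2l// sqr_ge0.
have p3 : h * n * (h * (c1 + 1)) <= h * n * (s / 2) by rewrite ler_wpM2l// mulr_ge0.
have p4 : 0 <= h ^+ 2 * n by rewrite mulr_ge0// sqr_ge0.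
by lra.
Qed.

Lemma weak_solution_ge0 H L i j rho : is_herm H -> weak_solution H L i j rho ->
  (forall v, 0 <= re_form (rho 0) v) -> forall t v, 0 <= t -> 0 <= re_form (rho t) v.
Proof.
move=> hH sol rho0.
have [c2 c20 c2P] := re_form_bounded (lindblad H L i j 1%:M).
pose lam := c2 + 1.
have eps_ge0 (eps : R) : 0 < eps -> forall t, 0 <= t ->
    forall v, 0 <= re_form (rho t) v + eps * expR (lam * t) * sqnorm v.
  (* The inductive property quantifies over all [v], so the step length in the last case has to be
     uniform in [v]; this is why all error bounds are relative to [sqnorm v]. *)
  move=> eps0; apply: continuous_induction.
  - move=> v; rewrite mulr0 expR0 mulr1 addr_ge0// mulr_ge0 ?sqnorm_ge0//.
    exact: ltW.
  - move=> t t0 Pt v; apply: (closed_ge0 (f := fun s =>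
      re_form (rho s) v + eps * expR (lam * s) * sqnorm v)) => //; last first.
      by move=> s st; exact: Pt.
    apply: continuousD.
      have -> : (fun s => re_form (rho s) v) =
          (fun s => complex.Re (\tr ((v *m dag v) *m rho s))).
        by apply/funext => s; rewrite re_form_mxtrace.
      exact: is_derive_continuous (sol _ t).
    apply: continuousM; last exact: cst_continuous.
    apply: continuousM; first exact: cst_continuous.
    apply: continuous_comp; last exact: continuous_expR.
    exact: mulrl_continuous.
  move=> t t0 Pt; set s := eps * expR (lam * t).
  have s0 : 0 < s by rewrite mulr_gt0// expR_gt0.
  pose Y := rho t + ((s%:C)%C)%:M.
  have Y0 w : 0 <= re_form Y w by rewrite re_formD re_form_scalar; exact: Pt.
  have [c1 c10 c1P] := re_form_bounded (drift H L i j *m Y *m dag (drift H L i j)).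
  have s2 : 0 < s / 2 by rewrite divr_gt0.
  have /nbhs_ballP[d/= d0 dP] := weak_solution_first_order t sol s2.
  have c11 : 0 < c1 + 1 by lra.
  (* Below [d] the first-order estimate holds; the second bound makes the [h^2] term small against
     [s h]. *)
  exists (Num.min d (s / 2 / (c1 + 1))).
    by rewrite lt_min d0/= divr_gt0.
  move=> h /andP[h0]; rewrite lt_min => /andP[hd hs] v.
  have {}dP : `|re_form (rho (t + h) - rho t - (h%:C)%C *: lindblad H L i j (rho t)) v|
      <= s / 2 * h * sqnorm v.
    have := dP h; rewrite /ball/= sub0r normrN ger0_norm// => /(_ hd)/(_ v).
    by [].
  have eu := euler_step_ge0 L i j v hH h0 Y0.
  rewrite {1 2}/Y lindblad_shift// scalerDr scalerA -rmorphM/= in eu.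
  apply: (euler_step_arith (r0 := re_form (rho t) v)
    (z := re_form (lindblad H L i j (rho t)) v) s0 h0 (sqnorm_ge0 v) c10 c20
    _ _ (c1P v) (c2P v)).
  - move: dP; move: (lindblad _ _ _ _ _) => Z; by rewrite !(re_formB, re_formZ).
  - move: (drift H L i j *m Y *m dag (drift H L i j)) eu => Q.
    move: (lindblad _ _ _ _ 1%:M) (lindblad _ _ _ _ _) => Z1 Z.
    by rewrite !(re_formD, re_formZ, re_form_scalar) mulrDr mulrA.
  - by rewrite -ler_pdivlMr// ltW.
  (* The regularisation at [t + h] covers the loss because [e^(lam h) >= 1 + lam h]. *)
  rewrite ler_wpM2r ?sqnorm_ge0// [lam * _]mulrDr expRD mulrA -/s.
  rewrite ler_wpM2l// ?(ltW s0)//.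
  exact: expR_ge1Dx.
move=> t v t0; rewrite leNgt; apply/negP => rlt0.
have E0 : 0 < expR (lam * t) * sqnorm v + 1.
  by rewrite ltr_wpDl// mulr_ge0 ?sqnorm_ge0// expR_ge0.
(* Chosen so that the regularisation makes up at most half of a negative value of the form; the 1 in
   the denominator covers [v = 0]. *)
pose eps := - re_form (rho t) v / 2 / (expR (lam * t) * sqnorm v + 1).
have eps0 : 0 < eps by rewrite !divr_gt0// oppr_gt0.
have := eps_ge0 eps eps0 t t0 v; rewrite -mulrA.
have : eps * (expR (lam * t) * sqnorm v) <= - re_form (rho t) v / 2.
  rewrite -[leRHS](divfK (lt0r_neq0 E0)) -/eps ler_wpM2l ?(ltW eps0)//.
  by rewrite lerDl.
by lra.
Qed.

End Evolution.

(** * Exponential decay from a differential inequality *)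

Section Decay.
Context {R : realType}.

(** Grönwall's argument: [y t * e^(k t)] has nonpositive derivative for [t > 0]. *)
Lemma exp_decay (y dy : R -> R) (k : R) :
  (forall t : R, is_derive t 1 y (dy t)) ->
  (forall t, 0 <= t -> dy t <= - k * y t) ->
  forall t, 0 <= t -> y t <= y 0 * expR (- k * t).
Proof.
move=> ydy dyk t t0; pose w s := y s * expR (k * s).
have dw (s : R) : is_derive s 1 w (y s * (k * expR (k * s)) + expR (k * s) * dy s).
  have dlin : is_derive s 1 ( *%R k) k.
    by apply: (is_derive_eq (is_deriveZ k (is_derive_id s 1))); rewrite scaler1.
  have dexp : is_derive s 1 (fun x => expR (k * x)) (expR (k * s) * k).
    exact: (@is_derive1_comp _ expR ( *%R k)).
  apply: (is_derive_eq (is_deriveM (ydy s) dexp)).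
  by rewrite /GRing.scale/=; ring.
have wle : w t <= w 0.
  apply: (ler0_derive1_nincry (f := w) (a := 0)) => //.
  - move=> s; rewrite in_itv/= andbT => s0; rewrite derive1E; case: (dw s) => _ ->.
    have := dyk s (ltW s0); have := expR_gt0 (k * s); move: (expR _) => E.
    by move=> E0 le_dy; have := ler_wpM2l (ltW E0) le_dy; lra.
  - by apply: derivable_within_continuous => s _; have [dws _] := dw s; exact: dws.
move: wle; rewrite /w mulr0 expR0 mulr1 mulNr expRN.
by rewrite ler_pdivlMr// expR_gt0.
Qed.

Lemma exp_squeeze (f : R -> R) (A k : R) : 0 < k ->
  (forall t, 0 <= t -> 0 <= f t <= A * expR (- k * t)) ->
  (f t @[t --> +oo] --> (0 : R))%classic.
Proof.
move=> k0 fA; apply: (@squeeze_cvgr _ _ _ _ (cst 0) (fun t => A * expR (- k * t))).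
- by near=> t; apply: fA; near: t; exact: nbhs_pinfty_ge.
- exact: cvg_cst.
rewrite -(mulr0 A); apply: cvgMr.
under eq_fun do rewrite mulNr.
apply: (@cvg_comp _ _ _ (fun t => k * t) (fun t => expR (- t)) _ +oo%R);
  last exact: cvgr_expR.
exact: gt0_cvgMry.
Unshelve. all: by end_near. Qed.

End Decay.

(** * Stability criterion for a single observable *)

Section Stability.
Context {R : realType} {dim : nat}.
Local Notation C := (R[i]).
Local Notation M := ('M[C]_dim).
Implicit Types (A B X Y V H : M) (L : nat -> M) (rho : R -> M).

Lemma re_form_iZ A (v : 'cV[C]_dim) :
  re_form (('i)%C *: A) v = - complex.Im ((dag v *m A *m v) 0 0).
Proof.
rewrite /re_form -scalemxAr -scalemxAl mxE.
by case: ((dag v *m A *m v) 0 0) => a b /=; rewrite mul0r mul1r sub0r.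
Qed.

(* Positivity of the flow applied to [rho], [i rho] and [- i rho]. *)
Lemma solution_pos_form H L i j rho : is_herm H ->
  solves_lindblad H L i j rho -> is_psd (rho 0) ->
  forall t, 0 <= t -> pos_form (rho t).
Proof.
move=> hH /solves_lindblad_weak sol [_ p0] t t0 v.
have p0Im (w : 'cV[C]_dim) : complex.Im ((dag w *m rho 0 *m w) 0 0) = 0.
  by have := p0 w; rewrite lecE => /andP[/eqP].
have geRe : 0 <= re_form (rho t) v.
  apply: (weak_solution_ge0 hH sol _ v t0) => w.
  by have := p0 w; rewrite lecE => /andP[].
have leIm : 0 <= re_form (('i)%C *: rho t) v.
  apply: (weak_solution_ge0 hH (weak_solutionZ ('i)%C sol) _ v t0) => w.
  by rewrite re_form_iZ p0Im oppr0.
have geIm : 0 <= re_form (((-1)%:C)%C *: (('i)%C *: rho t)) v.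
  apply: (weak_solution_ge0 hH
    (weak_solutionZ _ (weak_solutionZ ('i)%C sol)) _ v t0) => w.
  by rewrite re_formZ re_form_iZ p0Im oppr0 mulr0.
rewrite re_formZ in geIm; rewrite re_form_iZ in leIm geIm.
rewrite lecE; apply/andP; split => //; apply/eqP => /=; lra.
Qed.

(** Scalars are annihilated by the generator; testing against 1 and [i] gives the real and imaginary
    parts of the trace. *)
Lemma solution_mxtrace H L i j rho t : solves_lindblad H L i j rho ->
  \tr (rho t) = \tr (rho 0).
Proof.
move=> /solves_lindblad_weak sol.
have cst (a : C) : complex.Re (a * \tr (rho t)) = complex.Re (a * \tr (rho 0)).
  rewrite -!mxtraceZ -!mul_scalar_mx.
  apply: (is_derive_0_is_cst (f := fun s => complex.Re (\tr (a%:M *m rho s)))) => s.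
  apply: (is_derive_eq (sol a%:M s)).
  by rewrite mxtrace_lindblad ?Gen_scalar ?mul0mx ?mxtrace0// scalar_mxC.
have := cst 1; have := cst ('i)%C; rewrite !mul1r.
move: (\tr (rho t)) (\tr (rho 0)) => [a b] [c d] /=.
by rewrite !mul0r !mul1r !sub0r => /oppr_inj -> ->.
Qed.

(** The condition on the generator by itself only makes [tr (V rho_t)] nonincreasing, where
    [V = X - d]. The decay rate comes from the operator [Y >= V] of [lyapunov_exists], which
    commutes with [H] because it is a polynomial in [V]. *)
Lemma dissipation_stable H L i j X (d c : R) :
  is_herm H -> is_herm X -> X *m H = H *m X -> 0 < c ->
  is_psd (X - ((d%:C)%C)%:M) ->
  is_psd (- Gen L i j X) ->
  is_psd (Diss L i j X - (c%:C)%C *: (X - ((d%:C)%C)%:M)) ->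
  forall rho, is_density (rho 0) -> solves_lindblad H L i j rho ->
    (complex.Re (\tr (X *m rho t)) @[t --> +oo] --> d)%classic /\
    (complex.Im (\tr (X *m rho t)) @[t --> +oo] --> (0 : R))%classic.
Proof.
move=> hH hX XH c0 pV pG pD rho [p0 tr0] sol.
have [V defV] : exists V, V = X - ((d%:C)%C)%:M by exists (X - ((d%:C)%C)%:M).
rewrite -defV in pV pD.
have GV : Gen L i j V = Gen L i j X by rewrite defV GenB Gen_scalar subr0.
rewrite -GV in pG; rewrite -(Diss_shift L i j d hX) -defV in pD.
have VH : V *m H = H *m V by rewrite defV mulmxBl mulmxBr XH scalar_mxC.
have [Y [k [YH k0 pYV pGY]]] : exists Y (k : R), [/\ Y *m H = H *m Y, 0 < k,
    is_psd (Y - V) & is_psd (- Gen L i j Y - (k%:C)%C *: Y)].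
  have [s [k [k0 pYV pGY]]] := lyapunov_exists c0 pV pG pD.
  exists ((s%:C)%C *: V - V *m V), k; split; [ | exact: k0 | exact: pYV | exact: pGY].
  rewrite mulmxBl mulmxBr -scalemxAl -scalemxAr VH; congr (_ - _).
  by rewrite -mulmxA VH mulmxA VH mulmxA.
have pos := solution_pos_form hH sol p0.
have ReP A t : is_psd A -> 0 <= t -> 0 <= complex.Re (\tr (A *m rho t)).
  move=> pA t0; have := mxtrace_psd_ge0 pA (pos _ t0).
  by rewrite lecE => /andP[].
have ReB A B t : complex.Re (\tr ((A - B) *m rho t)) =
    complex.Re (\tr (A *m rho t)) - complex.Re (\tr (B *m rho t)).
  by rewrite mulmxBl raddfB/=; case: (\tr _) (\tr _) => ? ? [].
have dY (t : R) : is_derive t 1 (fun u => complex.Re (\tr (Y *m rho u)))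
    (complex.Re (\tr (Gen L i j Y *m rho t))).
  by rewrite -(mxtrace_lindblad L i j (rho t) YH); exact: (solves_lindblad_weak sol).
have dYle t : 0 <= t ->
    complex.Re (\tr (Gen L i j Y *m rho t)) <= - k * complex.Re (\tr (Y *m rho t)).
  move=> t0; have := ReP _ _ pGY t0; rewrite ReB.
  rewrite mulNmx raddfN -scalemxAl mxtraceZ ReZ/=.
  by case: (\tr (Gen L i j Y *m rho t)) => a b /=; rewrite mulNr; lra.
have decay t : 0 <= t -> 0 <= complex.Re (\tr (V *m rho t))
    <= complex.Re (\tr (Y *m rho 0)) * expR (- k * t).
  move=> t0; apply/andP; split; first exact: (ReP _ _ pV t0).
  apply: le_trans (exp_decay dY dYle t0).
  by rewrite -subr_ge0 -ReB; exact: (ReP _ _ pYV t0).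
have Vcvg := exp_squeeze k0 decay.
have XV t : \tr (X *m rho t) = \tr (V *m rho t) + (d%:C)%C.
  have -> : X = V + ((d%:C)%C)%:M by rewrite defV subrK.
  rewrite mulmxDl raddfD/=.
  by rewrite mul_scalar_mx mxtraceZ (solution_mxtrace t sol) tr0 mulr1.
split.
  under eq_fun do rewrite XV ReD.
  by have := cvgD Vcvg (cvg_cst d); rewrite add0r; apply.
(* For [t >= 0] the trace of [V] against the state is a nonnegative complex number, so its imaginary
   part is exactly 0. *)
apply: cvg_near_cst; near=> t.
have t0 : 0 <= t by near: t; exact: nbhs_pinfty_ge.
rewrite XV; have := mxtrace_psd_ge0 pV (pos _ t0).
rewrite lecE => /andP[/eqP + _].
by case: (\tr _) => a b /= ->; rewrite addr0.
Unshelve. all: by end_near. Qed.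

End Stability.

(** * Passage from [Wtil W n] to [Wtil W n.+1] *)

Lemma min_eig_unique (R : realType) (dim : nat) (A : 'M[R[i]]_dim) (d e : R) :
  min_eig A d -> min_eig A e -> d = e.
Proof.
move=> [Ad mind] [Ae mine]; apply/le_anti.
by rewrite -!lecR; apply/andP; split; [exact: mind Ae | exact: mine Ad].
Qed.

Theorem theorem20 (R : realType) (dim : nat) (H : 'M[R[i]]_dim)
  (N : nat) (W : nat -> 'M[R[i]]_dim) (d : nat -> R)
  (L : nat -> 'M[R[i]]_dim) (M K n : nat) (c : R) :
  is_herm H ->
  (forall l, (1 <= l <= N)%N ->
     [/\ is_herm (W l), W l *m H = H *m W l, is_psd (W l) & min_eig (W l) 0]) ->
  (forall m, (1 <= m <= N)%N -> min_eig (Wtil W m) (d m)) ->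
  (1 <= n < N)%N ->
  (M <= K)%N ->
  0 < c ->
  loewner_le (Gen L 1 M.+1 (Wtil W n)) 0 ->
  loewner_le ((c%:C)%C *: (Wtil W n - ((d n)%:C)%C%:M))
             (Diss L 1 M.+1 (Wtil W n - ((d n)%:C)%C%:M)) ->
  loewner_le (Gen L 1 K.+1 (W n.+1)
              + \sum_(M.+1 <= k < K.+1) GenL (L k) (Wtil W n)) 0 ->
  loewner_le ((c%:C)%C *: W n.+1 - ((c * (d n.+1 - d n))%:C)%C%:M)
             (Diss L 1 K.+1 (W n.+1)
              + 2%:R *: \sum_(1 <= k < K.+1)
                   ReOp (opcomm (dag (L k)) (Wtil W n) *m opcomm (W n.+1) (L k))) ->
  ag_stable H L 1 K.+1 (Wtil W n.+1).
Proof.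
move=> hH HW Hd /andP[n1 nN] MK c0 G1 D1 G2 D2.
have WtilS : Wtil W n.+1 = Wtil W n + W n.+1 by rewrite /Wtil big_nat_recr.
have Wn l : (1 <= l <= N)%N -> is_herm (W l) /\ W l *m H = H *m W l.
  by move=> /HW[].
have Wtn : is_herm (Wtil W n) /\ Wtil W n *m H = H *m Wtil W n.
  have lN l : (1 <= l < n.+1)%N -> (1 <= l <= N)%N.
    by move=> /andP[-> ln] /=; rewrite ltnW// (leq_ltn_trans _ nN).
  rewrite /Wtil; split.
    rewrite /is_herm dag_sum; apply: eq_big_nat => l /lN.
    by move=> /Wn[].
  rewrite mulmx_suml mulmx_sumr; apply: eq_big_nat => l /lN.
  by move=> /Wn[].
have [hA AH] := Wtn; have [hB BH] := Wn n.+1 nN.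
set A := Wtil W n in WtilS hA AH G1 D1 G2 D2 *.
set B := W n.+1 in WtilS hB BH G2 D2 *.
have hAB : is_herm (A + B) by rewrite /is_herm dagD hA hB.
have ABH : (A + B) *m H = H *m (A + B) by rewrite mulmxDl mulmxDr AH BH.
have minX := Hd n.+1 nN.
move=> d' /(min_eig_unique minX) <- {d'}.
have pV : is_psd (A + B - (((d n.+1)%:C)%C)%:M).
  by apply: eigenvalue_ge_psd => //; rewrite -WtilS; case: minX.
rewrite WtilS; apply: (dissipation_stable hH hAB ABH c0 pV).
(* The generator of [A] is split at [M]: its first part is the hypothesis for the couplings [1..M],
   and the rest is grouped with the generator of [B]. *)
- have -> : - Gen L 1 K.+1 (A + B) = (0 - Gen L 1 M.+1 A) +
     (0 - (Gen L 1 K.+1 B + \sum_(M.+1 <= k < K.+1) GenL (L k) A)).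
    rewrite GenD [Gen L 1 K.+1 A](big_cat_nat _ (n := M.+1))//=.
    rewrite -/(Gen L 1 M.+1 A).
    move: (Gen L 1 M.+1 A) (Gen L 1 K.+1 B) (\sum_(_ <= k < _) _) => x y z.
    by rewrite !sub0r -opprD [y + z]addrC addrA.
  exact: is_psdD G1 G2.
(* The constants fit because [c d_n + c (d_(n+1) - d_n) = c d_(n+1)]; the cross terms of [Diss_add]
   are those of the last hypothesis. *)
have -> : Diss L 1 K.+1 (A + B) - (c%:C)%C *: (A + B - (((d n.+1)%:C)%C)%:M) =
    Diss L M.+1 K.+1 A
    + (Diss L 1 M.+1 A - (c%:C)%C *: (A - ((d n)%:C)%C%:M))
    + (Diss L 1 K.+1 B + 2%:R *: \sum_(1 <= k < K.+1)
          ReOp (opcomm (dag (L k)) A *m opcomm B (L k))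
       - ((c%:C)%C *: B - ((c * (d n.+1 - d n))%:C)%C%:M)).
  rewrite Diss_add//.
  have -> : Diss L 1 K.+1 A = Diss L 1 M.+1 A + Diss L M.+1 K.+1 A.
    by rewrite !Diss_herm// (big_cat_nat _ (n := M.+1)).
  rewrite rmorphM rmorphB/=.
  move: (Diss L 1 M.+1 A) (Diss L M.+1 K.+1 A) (Diss L 1 K.+1 B) => x y z.
  move: (\sum_(_ <= k < _) _) => S.
  move: (c%:C)%C ((d n.+1)%:C)%C ((d n)%:C)%C => c' d1 d2.
  have -> : (c' * (d1 - d2))%:M = c' *: d1%:M - c' *: d2%:M :> 'M[R[i]]_dim.
    by apply/matrixP => i j; rewrite !mxE; case: eqP => _;
      rewrite ?mulr1n ?mulr0n; ring.
  move: (d1%:M) (d2%:M) => e1 e2; move: (A) (B) => A' B'.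
  by apply/matrixP => i j; rewrite !mxE; ring.
rewrite /loewner_le (Diss_shift _ _ _ _ hA) in D1.
exact: is_psdD (is_psdD (Diss_psd _ _ _ hA) D1) D2.
Qed.
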